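(* Let $n\ge2$ and let $-1\le\alpha<\beta\le1$ with $\beta^2\ge\alpha^2$ and $(\alpha,\beta)\neq(-1,1)$. Let $S_\alpha=\{x\in B_n:x_1=\alpha\}$, $S_\beta=\{x\in B_n:x_1=\beta\}$, and let $Q_{\alpha\beta}=\mathrm{conv}(S_\alpha\cup S_\beta)$. The minimum volume circumscribed ellipsoid $\mathrm{CE}(Q_{\alpha\beta})$ has the form $E(X,c)$ where $c=\tau e_1$ and $X=\mathrm{diag}(a,b,\ldots,b)$, where the parameters $a>0$, $b>0$ and $\alpha<\tau<\beta$ are given as follows: (i) If $\alpha\beta=-1/n$, then $\tau=0$ and $a=b=1$. (ii) If $\alpha+\beta=0$ and $\alpha\beta\ne-1/n$, then $$\tau=0,\qquad a=\frac{1}{n\beta^2},\qquad b=\frac{n-1}{n(1-\beta^2)}.$$ (iii) If $\alpha+\beta\ne0$ and $\alpha\beta\ne-1/n$, then $$\tau=\frac{n(\beta+\alpha)^2+2(1+\alpha\beta)-\sqrt{\Delta}}{2(n+1)(\beta+\alpha)},\qquad a=\frac{1}{n(\tau-\alpha)(\beta-\tau)},\qquad b=\frac{1-a(\tau-\alpha)^2}{1-\alpha^2},$$ where $\Delta=n^2(\beta^2-\alpha^2)^2+4(1-\alpha^2)(1-\beta^2)$.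
   Context: $B_n=\{u\in\mathbb{R}^n:\|u\|\le1\}$ is the closed Euclidean unit ball, $e_1=(1,0,\ldots,0)^T$, and $\mathrm{conv}$ denotes convex hull. For a symmetric positive definite $n\times n$ matrix $X$ and $c\in\mathbb{R}^n$, $E(X,c)=\{x\in\mathbb{R}^n:\langle X(x-c),x-c\rangle\le 1\}$. A convex body is a compact convex set with nonempty interior. For a convex body $K\subset\mathbb{R}^n$, $\mathrm{CE}(K)$ denotes the unique ellipsoid of minimum volume containing $K$. *)

(* Defs.v *)
From HB Require Import structures.
From mathcomp Require Import all_boot all_order all_algebra.
From mathcomp Require Import all_classical all_reals all_analysis.

Set Implicit Arguments.
Unset Strict Implicit.
Unset Printing Implicit Defensive.

Import Order.TTheory GRing.Theory Num.Theory.
Import numFieldNormedType.Exports.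

Local Open Scope classical_set_scope.
Local Open Scope ring_scope.

Section tuple_cons.
Context (T : Type) (n : nat).

Definition tuple_cons (p : T * n.-tuple T) : n.+1.-tuple T :=
  [tuple of p.1 :: p.2].

Definition tuple_uncons (t : n.+1.-tuple T) : T * n.-tuple T :=
  (thead t, [tuple of behead t]).

Lemma tuple_consK : cancel tuple_cons tuple_uncons.
Proof.
by case=> x y; congr pair; apply/val_inj.
Qed.

Lemma tuple_unconsK : cancel tuple_uncons tuple_cons.
Proof. by move=> t; rewrite [RHS]tuple_eta. Qed.

End tuple_cons.


Section tuple_measure.
Local Open Scope ereal_scope.
Context d (T : measurableType d) (R : realType) (n : nat).
Variables (m : {sigma_finite_measure set T -> \bar R})
          (mn : {sigma_finite_measure set (n.-tuple T) -> \bar R}).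

Lemma measurable_tuple_cons :
  measurable_fun [set: T * n.-tuple T] (@tuple_cons T n).
Proof. exact: measurable_cons. Qed.

Lemma measurable_tuple_uncons :
  measurable_fun [set: n.+1.-tuple T] (@tuple_uncons T n).
Proof.
apply/measurable_fun_pairP; split; last exact: measurable_behead.
exact: measurable_tnth.
Qed.

Definition tuple_measure : set (n.+1.-tuple T) -> \bar R :=
  pushforward (m \x mn) (@tuple_cons T n).

Let tuple_measure0 : tuple_measure set0 = 0.
Proof. by rewrite /tuple_measure /pushforward preimage_set0 measure0. Qed.

Let tuple_measure_ge0 A : 0 <= tuple_measure A.
Proof. by rewrite /tuple_measure /pushforward; apply: measure_ge0. Qed.

Let tuple_measure_sigma_additive : semi_sigma_additive tuple_measure.
Proof.
move=> F mF tF mUF.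
have mpre A : measurable A -> measurable (@tuple_cons T n @^-1` A).
  by move=> mA; rewrite -[X in measurable X]setTI; exact: measurable_tuple_cons.
rewrite /tuple_measure /pushforward preimage_bigcup.
apply: measure_semi_sigma_additive.
- by move=> k; exact: mpre.
- apply/trivIsetP => /= i j _ _ ij; rewrite -preimage_setI.
  by move/trivIsetP : tF => /(_ _ _ _ _ ij) ->//; rewrite preimage_set0.
- by rewrite -preimage_bigcup; exact: mpre.
Qed.

HB.instance Definition _ := isMeasure.Build _ _ _ tuple_measure
  tuple_measure0 tuple_measure_ge0 tuple_measure_sigma_additive.

Let tuple_measure_sigma_finite : sigma_finite setT tuple_measure.
Proof.
have /sigma_finiteP[F [TF ndF Foo]] := sigma_finiteT m.
have /sigma_finiteP[G [TG ndG Goo]] := sigma_finiteT mn.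
exists (fun k => @tuple_uncons T n @^-1` (F k `*` G k)) => [|k].
  rewrite -preimage_bigcup (_ : \bigcup_k _ = setT) ?preimage_setT//.
  rewrite -subTset => -[x t] _.
  have [k _ Fkx] : (\bigcup_k F k) x by rewrite -TF.
  have [l _ Glt] : (\bigcup_k G k) t by rewrite -TG.
  exists (maxn k l) => //; split.
    by move: x Fkx; exact/subsetPset/ndF/leq_maxl.
  by move: t Glt; exact/subsetPset/ndG/leq_maxr.
have [mFk Fkoo] := Foo k; have [mGk Gkoo] := Goo k; split.
  rewrite -[X in measurable X]setTI; apply: measurable_tuple_uncons => //.
  exact: measurableX.
rewrite /tuple_measure /pushforward -comp_preimage.
rewrite (_ : _ \o _ = id) ?preimage_id; last exact/funext/tuple_consK.
by rewrite product_measure1E// lte_mul_pinfty// ge0_fin_numE.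
Qed.

HB.instance Definition _ := Measure_isSigmaFinite.Build _ _ _ tuple_measure
  tuple_measure_sigma_finite.

End tuple_measure.

(* n-dimensional Lebesgue measure, as the n-fold product of the library's
   one-dimensional Lebesgue measure, on the product sigma-algebra of R^n. *)
Fixpoint lebesgue_tuple (R : realType) (n : nat) :
    {sigma_finite_measure set (n.-tuple (measurableTypeR R)) -> \bar R} :=
  match n with
  | 0 => \d_ [tuple]
  | n'.+1 => tuple_measure (@lebesgue_measure R) (lebesgue_tuple R n')
  end.

Section euclidean.
Context (R : realType) (n : nat).
Implicit Types (x y c : 'cV[R]_n) (A K E : set 'cV[R]_n).

Definition volume A : \bar R :=
  lebesgue_tuple R n
    [set t : n.-tuple (measurableTypeR R) | A (\col_(i < n) tnth t i)].

Definition inner x y : R := \sum_(i < n) x i 0 * y i 0.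

(* The norm `|x| that the library puts on matrices is the sup norm, hence the
   separate Euclidean norm. *)
Definition enorm x : R := Num.sqrt (inner x x).

Definition unit_ball : set 'cV[R]_n := [set x | enorm x <= 1].

Definition convex_hull A : set 'cV[R]_n := smallest (@convex_set R 'cV[R]_n) A.

Definition posdef (X : 'M[R]_n) : Prop :=
  X^T = X /\ forall x, x != 0 -> 0 < inner (X *m x) x.

Definition ellipsoid_of (X : 'M[R]_n) c : set 'cV[R]_n :=
  [set x | inner (X *m (x - c)) (x - c) <= 1].

Definition is_ellipsoid E : Prop :=
  exists X c, posdef X /\ E = ellipsoid_of X c.

(* E = CE(K): E is an ellipsoid containing K whose volume is minimal among all
   ellipsoids containing K, and E is the only minimizer. *)
Definition is_CE K E : Prop :=
  [/\ is_ellipsoid E, K `<=` E &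
      forall E', is_ellipsoid E' -> K `<=` E' ->
        (volume E <= volume E')%E /\ (volume E' = volume E -> E' = E)].

Definition ball_slice (i : 'I_n) (a : R) : set 'cV[R]_n :=
  [set x | unit_ball x /\ x i 0 = a].

End euclidean.

(* The rectangle formula, which characterizes Lebesgue measure on R^n. *)
Lemma lebesgue_tuple_rect (R : realType) (n : nat)
    (A : 'I_n -> set (measurableTypeR R)) :
  (forall i, measurable (A i)) ->
  lebesgue_tuple R n [set t | forall i, A i (tnth t i)] =
  (\prod_(i < n) lebesgue_measure (A i))%E.
Proof.
elim: n A => [|n IHn] A mA.
  rewrite big_ord0 /= /dirac indicE mem_set// => i.
  by case: i.
rewrite big_ord_recl /= /tuple_measure /pushforward.
rewrite -IHn => [|i]; last exact: mA.
rewrite -product_measure1E//; last first.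
  rewrite (_ : [set _ | _] = \bigcap_(i in [set: 'I_n])
      ((fun t : n.-tuple (measurableTypeR R) => tnth t i) @^-1` A (lift ord0 i))).
    apply: fin_bigcap_measurable => // i _.
    by rewrite -[X in measurable X]setTI; exact: measurable_tnth.
  by apply/seteqP; split=> t /= tA i; [move=> _|]; exact: tA.
congr (_ _); apply/seteqP; split=> -[x t] /=.
  move=> xtA; split=> [|i]; first exact: (xtA ord0).
  by have := xtA (lift ord0 i); rewrite tnthS.
move=> [xA tA] i; case: (unliftP ord0 i) => [j|] ->; first by rewrite tnthS.
by [].
Qed.

(* Main.v *)
(* Let c = tau e_1 and X = diag(a, b, ..., b).  The parameters make both slices
   S_alpha and S_beta touch the boundary of E(X, c), and they carry a probability
   measure on the contact points with mean c and covariance X^-1 / n.  Averaging the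
   constraint <Y(u - d), u - d> <= 1 of a competitor E(Y, d) against that measure gives
   tr(Y X^-1) + n <Y(c - d), c - d> <= n.  Hadamard's inequality followed by AM-GM then
   yields det Y <= det X, with equality only for Y = X and d = c.  Since
   vol E(Y, d) = vol(B_n) / sqrt(det Y), this is minimality and uniqueness.  Both
   Hadamard's inequality and the volume formula are proved by induction on n, splitting
   off the first coordinate by completing the square (Schur complement). *)
Require Import Defs.
From mathcomp Require Import all_boot all_order all_algebra.
From mathcomp Require Import all_classical all_reals all_analysis.
From mathcomp Require Import measurable_realfun ring lra.
Import Order.TTheory GRing.Theory Num.Theory.
Local Open Scope classical_set_scope.
Local Open Scope ring_scope.

Set Implicit Arguments.
Unset Strict Implicit.
Unset Printing Implicit Defensive.

(** * Positive definite matrices *)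

Section inner_product.
Context {R : realType} {n : nat}.
Implicit Types (x y z : 'cV[R]_n) (Y : 'M[R]_n).

Lemma inner_mx x y : (x^T *m y) 0 0 = inner x y.
Proof. by rewrite mxE; apply: eq_bigr => i _; rewrite mxE. Qed.

Lemma innerC x y : inner x y = inner y x.
Proof. by apply: eq_bigr => i _; rewrite mulrC. Qed.

Lemma innerDl x y z : inner (x + y) z = inner x z + inner y z.
Proof. by rewrite -!inner_mx linearD mulmxDl mxE. Qed.

Lemma innerZl k x y : inner (k *: x) y = k * inner x y.
Proof. by rewrite -!inner_mx linearZ -scalemxAl mxE. Qed.

Lemma innerNl x y : inner (- x) y = - inner x y.
Proof. by rewrite -scaleN1r innerZl mulN1r. Qed.

Lemma innerDr x y z : inner x (y + z) = inner x y + inner x z.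
Proof. by rewrite !(innerC x) innerDl. Qed.

Lemma innerZr k x y : inner x (k *: y) = k * inner x y.
Proof. by rewrite !(innerC x) innerZl. Qed.

Lemma innerNr x y : inner x (- y) = - inner x y.
Proof. by rewrite !(innerC x) innerNl. Qed.

Lemma inner_deltar (x : 'cV[R]_n) i : inner x (delta_mx i 0) = x i 0.
Proof.
rewrite /inner (bigD1 i)//= big1 ?addr0 ?mxE ?eqxx ?mulr1// => j ji.
by rewrite mxE (negbTE ji) mulr0.
Qed.

Lemma inner_mul_delta Y i j : inner (Y *m delta_mx i 0) (delta_mx j 0) = Y j i.
Proof. by rewrite inner_deltar -colE mxE. Qed.

Lemma inner_symmetric Y x y : Y^T = Y -> inner (Y *m x) y = inner (Y *m y) x.
Proof.
by move=> sY; rewrite innerC -[LHS]inner_mx -[RHS]inner_mx trmx_mul sY mulmxA.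
Qed.

Lemma posdef_diag_gt0 Y i : posdef Y -> 0 < Y i i.
Proof.
move=> [_ /(_ (delta_mx i 0))]; rewrite inner_mul_delta; apply.
by apply/negP => /eqP/matrixP/(_ i 0)/eqP; rewrite !mxE !eqxx oner_eq0.
Qed.

Lemma posdef_inner_ge0 Y x : posdef Y -> 0 <= inner (Y *m x) x.
Proof.
move=> [_ Yx]; have [->|/Yx/ltW//] := eqVneq x 0.
by rewrite mulmx0 -(scale0r (0 : 'cV[R]_n)) innerZl mul0r.
Qed.

End inner_product.

(** * Schur complements, determinants and Hadamard's inequality *)

Section schur_complement.
Context {R : realType} {n : nat}.
Implicit Types (Y : 'M[R]_n.+1) (x : 'cV[R]_n.+1).

Definition corner Y : 'cV[R]_n := \col_i Y (lift ord0 i) ord0.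

(** For symmetric matrices [corner] serves as both the first column and the first row, so this is
    the Schur complement of the top left entry. The index [lift ord0 i] skips the first coordinate
    without any block decomposition of the size. *)
Definition schur Y : 'M[R]_n :=
  \matrix_(i, j) (Y (lift ord0 i) (lift ord0 j)
    - (Y ord0 ord0)^-1 * (corner Y i 0 * corner Y j 0)).

Definition tail x : 'cV[R]_n := \col_i x (lift ord0 i) 0.

(** Completing the square in the first coordinate absorbs every cross term; what is left over in the
    other coordinates is the form of the Schur complement. *)
Lemma inner_schur Y x : Y^T = Y -> Y ord0 ord0 != 0 ->
  inner (Y *m x) x =
  Y ord0 ord0 * (x ord0 0 + (Y ord0 ord0)^-1 * inner (corner Y) (tail x)) ^+ 2
  + inner (schur Y *m tail x) (tail x).
Proof.
move=> sY p0; set p := Y ord0 ord0 in p0 *.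
have Ysym i j : Y i j = Y j i by rewrite -[in LHS]sY mxE.
pose q := inner (corner Y) (tail x).
have Sx i : (schur Y *m tail x) i 0 =
    (Y *m x) (lift ord0 i) 0 - corner Y i 0 * (x ord0 0 + p^-1 * q).
  rewrite !mxE big_ord_recl /q /inner mulrDr.
  under eq_bigr => j _ do rewrite !mxE mulrBl.
  rewrite big_split/= sumrN.
  rewrite [X in _ - X](_ : _ = Y (lift ord0 i) ord0 * (p^-1 *
      \sum_(j < n) corner Y j 0 * tail x j 0)); first by ring.
  by rewrite !mulr_sumr; apply: eq_bigr => j _; rewrite !mxE -/p; ring.
rewrite {1}/inner big_ord_recl.
have -> : (Y *m x) ord0 0 = p * x ord0 0 + q.
  rewrite mxE big_ord_recl; congr (_ + _).
  by apply: eq_bigr => j _; rewrite !mxE Ysym.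
rewrite -/q [in X in _ = _ + X]/inner.
under [X in _ = _ + X]eq_bigr => i _ do rewrite Sx mulrBl.
rewrite [X in _ = _ + X]big_split/= sumrN.
rewrite [X in _ - X](_ : _ = (x ord0 0 + p^-1 * q) * q); last first.
  move: (_ + _ * _) => u; rewrite mulrC /q /inner mulr_suml.
  by apply: eq_bigr => i _; ring.
rewrite (eq_bigr (fun i => (Y *m x) (lift ord0 i) 0 * tail x i 0)); last first.
  by move=> i _; rewrite [tail x i 0]mxE.
by field.
Qed.

Lemma schur_posdef Y : posdef Y -> posdef (schur Y).
Proof.
move=> pY; have p0 := posdef_diag_gt0 ord0 pY; case: pY => sY pY; split.
  have Ysym i j : Y i j = Y j i by rewrite -[in LHS]sY mxE.
  apply/matrixP => i j; rewrite !mxE Ysym.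
  by rewrite (mulrC (Y (lift ord0 j) ord0)).
(* The first coordinate is chosen to annihilate the completed square, so the form of [Y] at [x]
   equals the form of [schur Y] at [z]. *)
move=> z z0; pose x : 'cV[R]_n.+1 := \col_i
  (if unlift ord0 i is Some j then z j 0
   else - ((Y ord0 ord0)^-1 * inner (corner Y) z)).
have xz : tail x = z by apply/colP => i; rewrite !mxE liftK.
have x0 : x != 0.
  by apply: contraNneq z0 => x0; rewrite -xz x0; apply/eqP/colP => i; rewrite !mxE.
have := pY _ x0; rewrite inner_schur ?gt_eqF// xz mxE unlift_none addNr.
by rewrite expr0n mulr0 add0r.
Qed.

Lemma det_schur Y : Y^T = Y -> Y ord0 ord0 != 0 ->
  \det Y = Y ord0 ord0 * \det (schur Y).
Proof.
move=> sY p0; set p := Y ord0 ord0 in p0 *.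
(* One step of Gaussian elimination: [L] has determinant 1 and clears the first column below the
   pivot, leaving an upper block triangular matrix. *)
pose L : 'M[R]_(1 + n) := block_mx 1%:M 0 (- p^-1 *: corner Y) 1%:M.
have -> : \det Y = \det (L *m (Y : 'M[R]_(1 + n))).
  by rewrite det_mulmx det_lblock !det1 !mul1r.
rewrite -[Y in L *m Y](@submxK _ 1 n 1 n) mulmx_block !mul1mx !mul0mx !addr0.
have ulE : @ulsubmx _ 1 n 1 n Y = p%:M.
  by apply/matrixP => i j; rewrite !ord1 !mxE; congr (Y _ _); apply/val_inj.
have dlE : @dlsubmx _ 1 n 1 n Y = corner Y.
  by apply/matrixP => i j; rewrite !ord1 !mxE; congr (Y _ _); apply/val_inj.
rewrite [X in block_mx _ _ X](_ : _ = 0); last first.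
  rewrite ulE dlE mul_mx_scalar scalerA mulrN mulfV// scaleN1r.
  by rewrite addNr.
rewrite det_ublock ulE det_scalar1; congr (_ * \det _).
apply/matrixP => i j; rewrite !mxE big_ord1 !mxE.
rewrite -/p mulNr mulNr addrC mulrA; congr (Y _ _ - _ * _); try exact/val_inj.
by rewrite -[in LHS]sY mxE; congr (Y _ _); exact/val_inj.
Qed.

End schur_complement.

Lemma posdef_det_gt0 (R : realType) n (Y : 'M[R]_n) : posdef Y -> 0 < \det Y.
Proof.
elim: n Y => [|n IHn] Y pY; first by rewrite det_mx00.
have p0 := posdef_diag_gt0 ord0 pY; rewrite det_schur ?gt_eqF//; last by case: pY.
by rewrite mulr_gt0// IHn//; exact: schur_posdef.
Qed.

(** Used for the equality case in Hadamard's inequality. Replacing all factors of the [g]-product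
    but the [i]-th by the smaller ones of [f] gives g_i P <= f_i P, where P > 0 is the product of
    the other f_j; cancelling P leaves g_i <= f_i. *)
Lemma prodr_eq_ge (R : realType) (I : finType) (f g : I -> R) :
  (forall i, 0 < f i <= g i) -> \prod_i f i = \prod_i g i -> f =1 g.
Proof.
move=> fg fgE i; apply/eqP; rewrite eq_le; have /andP[_ ->]/= := fg i.
have gf0 : 0 < \prod_(j | j != i) f j.
  by apply: prodr_gt0 => j _; have /andP[] := fg j.
have g0 : 0 < g i by have /andP[] := fg i; exact: lt_le_trans.
have := fgE; rewrite (bigD1 i)//= [RHS](bigD1 i)//= => E.
rewrite -(ler_pM2r gf0) E ler_pM2l//; apply: ler_prod => j _.
by have /andP[/ltW -> ->] := fg j.
Qed.

(** Passing to the Schur complement lowers each diagonal entry by a square over the pivot, so the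
    bound follows by induction. In the equality case all these squares vanish, so the first row and
    column are zero off the diagonal and the Schur complement is the remaining block, which is
    diagonal by induction. *)
Lemma hadamard (R : realType) n (Y : 'M[R]_n) : posdef Y ->
  \det Y <= \prod_i Y i i /\ (\det Y = \prod_i Y i i -> is_diag_mx Y).
Proof.
elim: n Y => [|n IHn] Y pY.
  by rewrite det_mx00 big_ord0; split=> // _; apply/is_diag_mxP => -[].
have p0 := posdef_diag_gt0 ord0 pY; have pS := schur_posdef pY.
have sY : Y^T = Y by case: pY.
have [IH1 IH2] := IHn _ pS.
rewrite det_schur ?gt_eqF// big_ord_recl ler_pM2l//.
have S_le i : 0 < schur Y i i <= Y (lift ord0 i) (lift ord0 i).
  rewrite posdef_diag_gt0//= mxE lerBlDr lerDl mulr_ge0// ?invr_ge0 ?(ltW p0)//.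
  by rewrite -expr2 sqr_ge0.
have prodS : \prod_i schur Y i i <= \prod_i Y (lift ord0 i) (lift ord0 i).
  by apply: ler_prod => i _; have /andP[/ltW -> ->] := S_le i.
split; first exact: le_trans prodS.
have pN0 : Y ord0 ord0 != 0 by rewrite gt_eqF.
move/(mulfI pN0) => detE.
have prodE : \prod_i schur Y i i = \prod_i Y (lift ord0 i) (lift ord0 i).
  by apply/eqP; rewrite eq_le prodS -detE IH1.
have SE := prodr_eq_ge S_le prodE.
have c0 i : Y (lift ord0 i) ord0 = 0.
  move/eqP: (SE i); rewrite !mxE -subr_eq0 addrAC subrr add0r oppr_eq0 mulf_eq0.
  by rewrite invr_eq0 gt_eqF//= mulf_eq0 orbb => /eqP.
have /is_diag_mxP dS : is_diag_mx (schur Y) by apply: IH2; rewrite detE prodE.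
apply/is_diag_mxP => i j; case: (unliftP ord0 i) => [i'|] ->;
  case: (unliftP ord0 j) => [j'|] -> //= ij.
- have := dS i' j'; rewrite !mxE !c0 mulr0 mulr0 subr0; apply.
  by apply: contra_neq ij => /= ->.
- by rewrite -sY mxE.
Qed.

(** * Volume of ellipsoids *)

Section lebesgue_measure_affine.
Local Open Scope ereal_scope.
Context {R : realType}.
Local Notation mu := (@lebesgue_measure R).

(** The image of Lebesgue measure under the affine map, rescaled by a, agrees with Lebesgue measure
    on half-open intervals, and these determine the measure. *)
Lemma lebesgue_measure_affine (a b : R) (A : set (measurableTypeR R)) :
  (0 < a)%R -> measurable A ->
  mu ((fun s => a * s + b)%R @^-1` A) = (a^-1)%:E * mu A.
Proof.
move=> a0 mA; pose f (s : measurableTypeR R) : measurableTypeR R := (a * s + b)%R.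
have mf : measurable_fun [set: measurableTypeR R] f.
  by apply: measurable_funD => //; exact: measurable_funM.
have -> : mu A = pushforward (mscale (NngNum (ltW a0)) mu) f A.
  apply: lebesgue_measure_unique mA => // _ [[x y]] _ <-.
  rewrite /= /pushforward /mscale/=.
  have -> : f @^-1` [set` `]x, y]%R] =
      [set` `]((x - b) / a)%R, ((y - b) / a)%R]%R].
    apply/seteqP; split=> s; rewrite /= !in_itv/= /f ltr_pdivrMr// ler_pdivlMr//;
      by rewrite (mulrC s) ltrBlDr lerBrDr.
  rewrite !lebesgue_measure_itv/= !lte_fin ltr_pM2r ?invr_gt0// ltrD2r.
  case: ifPn => _; last by rewrite mule0.
  by rewrite -!EFinB -EFinM; congr EFin; field; rewrite gt_eqF.
by rewrite /pushforward /mscale/= muleA -EFinM mulVf ?gt_eqF// mul1e.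
Qed.

Lemma ge0_integral_affine (a b : R) (g : measurableTypeR R -> \bar R) :
  (0 < a)%R -> measurable_fun setT g -> (forall s, 0 <= g s) ->
  \int[mu]_s g (a * s + b)%R = (a^-1)%:E * \int[mu]_s g s.
Proof.
move=> a0 mg g0; pose f (s : measurableTypeR R) : measurableTypeR R := (a * s + b)%R.
have mf : measurable_fun [set: measurableTypeR R] f.
  by apply: measurable_funD => //; exact: measurable_funM.
have ia0 : (0 <= a^-1)%R by rewrite invr_ge0 ltW.
transitivity (\int[pushforward mu f]_s g s); first by rewrite ge0_integral_pushforward.
rewrite -(ge0_integral_mscale _ measurableT (NngNum ia0))//.
apply: eq_measure_integral => //.
by move=> A mA _ /=; rewrite /pushforward lebesgue_measure_affine.
Qed.

End lebesgue_measure_affine.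

(** * Integrals of functions of a quadratic form *)

Section lebesgue_tuple_integral.
Local Open Scope ereal_scope.
Context {R : realType}.
Local Notation mu := (@lebesgue_measure R).

Definition col_tuple n (t : n.-tuple (measurableTypeR R)) : 'cV[R]_n :=
  \col_i tnth t i.

Lemma col_tuple_cons0 n s (t : n.-tuple (measurableTypeR R)) :
  col_tuple (tuple_cons (s, t)) ord0 0%R = s.
Proof. by rewrite mxE. Qed.

Lemma tail_col_tuple_cons n s (t : n.-tuple (measurableTypeR R)) :
  tail (col_tuple (tuple_cons (s, t))) = col_tuple t.
Proof. by apply/colP => i; rewrite !mxE tnthS. Qed.

(** Tonelli's theorem, with the first coordinate innermost because the square is completed along
    it. *)
Lemma integral_lebesgue_tupleS n (F : n.+1.-tuple (measurableTypeR R) -> \bar R) :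
  measurable_fun setT F -> (forall t, 0 <= F t) ->
  \int[lebesgue_tuple R n.+1]_t F t =
  \int[lebesgue_tuple R n]_t \int[mu]_s F (tuple_cons (s, t)).
Proof.
move=> mF F0.
have mcons := @measurable_tuple_cons _ (measurableTypeR R) n.
transitivity (\int[pushforward (mu \x lebesgue_tuple R n)
    (@tuple_cons (measurableTypeR R) n)]_t F t); first by [].
rewrite ge0_integral_pushforward// preimage_setT.
rewrite (fubini_tonelli2 (F \o _))//; first exact: (measurableT_comp mF mcons).
by move=> z; exact: F0.
Qed.

Lemma measurable_quadratic n (Y : 'M[R]_n) (c : 'cV[R]_n) :
  measurable_fun [set: n.-tuple (measurableTypeR R)]
    (fun t => inner (Y *m (col_tuple t - c)) (col_tuple t - c)).
Proof.
apply: measurable_sum => i; apply: measurable_funM => /=.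
  under eq_fun do rewrite mxE; apply: measurable_sum => j.
  apply: measurable_funM => //; under eq_fun do rewrite !mxE.
  by apply: measurable_funB => //; exact: measurable_tnth.
under eq_fun do rewrite !mxE.
by apply: measurable_funB => //; exact: measurable_tnth.
Qed.

(** An arbitrary [g] is needed for the induction: even if [g] is an indicator, integrating out the
    first coordinate replaces it by the function [h] below, evaluated at the form of the Schur
    complement. Each coordinate contributes the inverse root of its pivot, and the pivots multiply
    to the determinant. *)
Lemma integral_quadratic n (Y : 'M[R]_n) (c : 'cV[R]_n)
    (g : measurableTypeR R -> \bar R) :
  posdef Y -> measurable_fun setT g -> (forall s, 0 <= g s) ->
  \int[lebesgue_tuple R n]_t g (inner (Y *m (col_tuple t - c)) (col_tuple t - c)) =
  ((Num.sqrt (\det Y))^-1)%:E *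
  \int[lebesgue_tuple R n]_t g (inner (col_tuple t) (col_tuple t)).
Proof.
elim: n Y c g => [|n IHn] Y c g pY mg g0.
  rewrite det_mx00 sqrtr1 invr1 mul1e; apply: eq_integral => t _.
  by rewrite /inner !big_ord0.
have p0 := posdef_diag_gt0 ord0 pY; have sY : Y^T = Y by case: pY.
set p := Y ord0 ord0 in p0.
have r0 : (0 < Num.sqrt p)%R by rewrite sqrtr_gt0.
pose h (w : measurableTypeR R) := \int[mu]_s g (s ^+ 2 + w)%R.
have h0 w : 0 <= h w by apply: integral_ge0 => s _; exact: g0.
have mh : measurable_fun setT h.
  apply: (measurable_fun_fubini_tonelli_G
    (fun z : measurableTypeR R * measurableTypeR R => g (z.1 ^+ 2 + z.2)%R)) => //.
  apply: measurableT_comp => //; apply: measurable_funD => //.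
  by apply: measurable_funX.
have mquad0 m : measurable_fun [set: m.-tuple (measurableTypeR R)]
    (fun t => inner (col_tuple t) (col_tuple t)).
  rewrite [X in measurable_fun _ X](_ : _ =
    (fun t => inner (1%:M *m (col_tuple t - 0)) (col_tuple t - 0))).
    exact: measurable_quadratic.
  by apply/funext => t; rewrite subr0 mul1mx.
rewrite integral_lebesgue_tupleS//; last first.
  by apply: (measurableT_comp mg); exact: measurable_quadratic.
rewrite integral_lebesgue_tupleS//; last first.
  by apply: (measurableT_comp mg); exact: mquad0.
have sliceE t : \int[mu]_s g (inner
      (Y *m (col_tuple (tuple_cons (s, t)) - c)) (col_tuple (tuple_cons (s, t)) - c)) =
    ((Num.sqrt p)^-1)%:E *
      h (inner (schur Y *m (col_tuple t - tail c)) (col_tuple t - tail c)).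
  set w := inner (schur Y *m _) _.
  (* The substitution sends s to the square root of the completed square: the scale is the root of
     the pivot, and the shift collects the centre and the cross term. *)
  rewrite /h -(@ge0_integral_affine R _
    (Num.sqrt p * (p^-1 * inner (corner Y) (col_tuple t - tail c) - c ord0 0%R))%R
    (fun u => g (u ^+ 2 + w)%R) r0)//.
    apply: eq_integral => s _; congr g; rewrite inner_schur ?gt_eqF//.
  have -> : tail (col_tuple (tuple_cons (s, t)) - c) = (col_tuple t - tail c)%R.
    by rewrite -(tail_col_tuple_cons s t); apply/colP => i; rewrite !mxE.
  rewrite -/w -/p -mulrDr exprMn sqr_sqrtr ?ltW// mxE col_tuple_cons0 mxE.
  by congr (_ * _ ^+ 2 + _)%R; ring.
  by apply: (measurableT_comp mg); exact: measurable_funD.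
rewrite (funext sliceE).
rewrite ge0_integralZl_EFin//; last first.
  by apply: (measurableT_comp mh); exact: measurable_quadratic.
rewrite IHn//; last exact: schur_posdef.
rewrite muleA -EFinM -invfM -sqrtrM ?ltW// -det_schur ?gt_eqF//.
(* The standard form splits as s^2 plus the form of the tail, so the same [h] arises on the
   right-hand side. *)
congr (_ * _); apply: eq_integral => t _; apply: eq_integral => s _; congr g.
rewrite [in RHS]/inner big_ord_recl col_tuple_cons0 -expr2; congr (_ + _)%R.
by apply: eq_bigr => i _; rewrite -(tail_col_tuple_cons s t) !mxE.
Qed.

End lebesgue_tuple_integral.

Section ellipsoid_volume.
Context {R : realType} {n : nat}.
Implicit Types (X Y : 'M[R]_n) (c d : 'cV[R]_n).

Let ball : set 'cV[R]_n := [set x | inner x x <= 1].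

Lemma measurable_quadratic_le Y c : measurable
  [set t : n.-tuple (measurableTypeR R) |
    inner (Y *m (col_tuple t - c)) (col_tuple t - c) <= 1].
Proof.
rewrite (_ : [set t | _] = (fun t => inner (Y *m (col_tuple t - c))
    (col_tuple t - c)) @^-1` [set` `]-oo, (1 : R)]]).
  by rewrite -[X in measurable X]setTI; exact: measurable_quadratic.
by apply/seteqP; split=> t /=; rewrite in_itv.
Qed.

Lemma measurable_ball :
  measurable [set t : n.-tuple (measurableTypeR R) | ball (col_tuple t)].
Proof.
rewrite (_ : [set t | _] = [set t : n.-tuple (measurableTypeR R) |
    inner (1%:M *m (col_tuple t - 0)) (col_tuple t - 0) <= 1]).
  exact: measurable_quadratic_le.
by apply/seteqP; split=> t /=; rewrite subr0 mul1mx.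
Qed.

(** The case of [integral_quadratic] where [g] is the indicator of the half-line up to 1. *)
Lemma volume_ellipsoid Y c : posdef Y ->
  volume (ellipsoid_of Y c) = ((Num.sqrt (\det Y))^-1%:E * volume ball)%E.
Proof.
move=> pY; pose g (r : measurableTypeR R) : \bar R := (\1_[set` `]-oo, (1 : R)]] r)%:E.
have := @integral_quadratic R n Y c g pY.
have gE (r : R) : g r = (r <= 1)%R%:R%:E.
  by rewrite /g indicE mem_setE in_itv.
have intE (q : n.-tuple (measurableTypeR R) -> R) :
    measurable [set t | q t <= 1] ->
    (\int[lebesgue_tuple R n]_t g (q t) = lebesgue_tuple R n [set t | (q t <= 1)%R])%E.
  by move=> mq; rewrite -[X in lebesgue_tuple R n X]setIT -integral_indic//.
rewrite !intE; [|exact: measurable_ball|exact: measurable_quadratic_le].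
apply; last by move=> s; rewrite gE lee_fin.
by apply/measurable_EFinP; exact: measurable_indic.
Qed.

Let cube (x y : R) : set (n.-tuple (measurableTypeR R)) :=
  [set t | forall i, [set` `[x, y]] (tnth t i)].

Let measurable_cube x y : measurable (cube x y).
Proof.
rewrite (_ : cube x y = \bigcap_(i in [set: 'I_n])
    ((fun t : n.-tuple (measurableTypeR R) => tnth t i) @^-1` [set` `[x, y]])).
  apply: fin_bigcap_measurable => // i _.
  by rewrite -[X in measurable X]setTI; exact: measurable_tnth.
by apply/seteqP; split=> t /= tA i; [move=> _|]; exact: tA.
Qed.

Let cube_measure x y : x < y ->
  lebesgue_tuple R n (cube x y) = ((y - x) ^+ n)%:E.
Proof.
move=> xy; rewrite (lebesgue_tuple_rect (A := fun=> [set` `[x, y]]))//.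
rewrite lebesgue_measure_itv/= lte_fin xy.
by rewrite big_const_ord iter_mule mule1 EFin_expe EFinD.
Qed.

Lemma volume_ball_gt0 : (0 < volume ball)%E.
Proof.
(* A cube of side 1/(n+1) fits in the ball: each squared coordinate is at most 1/(n+1), and n of
   them sum to less than 1. Taking n+1 keeps the side meaningful for n = 0. *)
have n1 : 0 < (n.+1%:R : R)^-1 by rewrite invr_gt0.
apply: (@lt_le_trans _ _ (lebesgue_tuple R n (cube 0 n.+1%:R^-1))).
  by rewrite cube_measure// lte_fin exprn_gt0// subr0.
apply: le_measure; rewrite ?inE//; first exact: measurable_ball.
move=> t At; rewrite /ball/=.
apply: (@le_trans _ _ (\sum_(i < n) (n.+1%:R^-1 : R))).
  apply: ler_sum => i _; rewrite mxE; have := At i; rewrite /= in_itv/= => /andP[t0 t1].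
  rewrite -[leRHS]mulr1 ler_pM//; apply: (le_trans t1).
  by rewrite invf_le1// ler1n.
rewrite sumr_const card_ord -[leLHS]mulr_natl ler_pdivrMr// mul1r ler_nat.
exact: leqnSn.
Qed.

Lemma volume_ball_lty : (volume ball < +oo)%E.
Proof.
apply: (@le_lt_trans _ _ (lebesgue_tuple R n (cube (- 1) 1))); last first.
  by rewrite cube_measure ?ltry// gtrN.
apply: le_measure; rewrite ?inE//; first exact: measurable_ball.
move=> t; rewrite /ball/= => tb i; rewrite /= in_itv/= -ler_norml.
rewrite -(@ler_pXn2r _ 2)// ?nnegrE// expr1n real_normK ?num_real//.
apply: le_trans tb; rewrite /inner (bigD1 i)//= mxE -expr2 lerDl.
by apply: sumr_ge0 => j _; rewrite -expr2 sqr_ge0.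
Qed.

Lemma volume_ellipsoid_le X Y c d : posdef X -> posdef Y ->
  (volume (ellipsoid_of X c) <= volume (ellipsoid_of Y d))%E =
  (\det Y <= \det X).
Proof.
move=> pX pY; rewrite !volume_ellipsoid//.
(* Finiteness and positivity of the volume of the ball allow it to be cancelled. *)
have : volume ball \is a fin_num.
  by rewrite ge0_fin_numE ?volume_ball_lty// ltW ?volume_ball_gt0.
have := volume_ball_gt0; case: (volume ball) => // r; rewrite lte_fin => r0 _.
have [X0 Y0] := (posdef_det_gt0 pX, posdef_det_gt0 pY).
rewrite -!EFinM lee_fin ler_pM2r// lef_pV2 ?posrE ?sqrtr_gt0//.
by rewrite ler_psqrt ?nnegrE// ltW.
Qed.

End ellipsoid_volume.

(** * The minimal ellipsoid *)

Lemma convexity_gap (R : realType) n (Y : 'M[R]_n) (x y : 'cV[R]_n) t : Y^T = Y ->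
  inner (Y *m (t *: x + (1 - t) *: y)) (t *: x + (1 - t) *: y) =
  t * inner (Y *m x) x + (1 - t) * inner (Y *m y) y
  - t * (1 - t) * inner (Y *m (x - y)) (x - y).
Proof.
move=> sY; rewrite !mulmxDr mulmxN -!scalemxAr.
rewrite !(innerDl, innerDr, innerNl, innerNr, innerZl, innerZr).
by rewrite (inner_symmetric y x sY); ring.
Qed.

Lemma ellipsoid_convex (R : realType) n (Y : 'M[R]_n) c :
  posdef Y -> convex_set (ellipsoid_of Y c).
Proof.
move=> pY; have cvx (x y : 'cV[R]_n) t : 0 <= t <= 1 -> ellipsoid_of Y c x ->
    ellipsoid_of Y c y -> ellipsoid_of Y c (t *: x + (1 - t) *: y).
  rewrite /ellipsoid_of/= => /andP[t0 t1] Ex Ey.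
  have -> : t *: x + (1 - t) *: y - c = t *: (x - c) + (1 - t) *: (y - c).
    by apply/colP => i; rewrite !mxE; ring.
  rewrite convexity_gap; last by case: pY.
  rewrite lerBlDr (@le_trans _ _ (t * 1 + (1 - t) * 1))//.
    by rewrite lerD// ler_wpM2l// subr_ge0.
  by rewrite !mulr1 addrC subrK lerDl !mulr_ge0 ?posdef_inner_ge0// subr_ge0.
by move=> x y l; rewrite !inE => Ex Ey; apply: cvx; rewrite ?ge0 ?le1.
Qed.

(** * Determinant comparison with a diagonal matrix *)

Section diagonal_form.
Context {R : realType} {n : nat} (v : 'rV[R]_n).

Lemma inner_diag (x : 'cV[R]_n) :
  inner (diag_mx v *m x) x = \sum_i v 0 i * x i 0 ^+ 2.
Proof. by apply: eq_bigr => i _; rewrite mul_diag_mx mxE -mulrA expr2. Qed.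

Hypothesis v0 : forall i, 0 < v 0 i.

Lemma posdef_diag_mx : posdef (diag_mx v).
Proof.
split=> [|x x0]; first exact: tr_diag_mx.
have F0 i : 0 <= v 0 i * x i 0 ^+ 2 by rewrite mulr_ge0 ?sqr_ge0// ltW.
rewrite inner_diag lt_neqAle sumr_ge0// andbT eq_sym.
apply: contra x0 => /eqP/(psumr_eq0P (fun i _ => F0 i)) vx0.
apply/eqP/colP => i; rewrite mxE; apply/eqP.
by have /eqP := vx0 i isT; rewrite mulf_eq0 gt_eqF//= sqrf_eq0.
Qed.

(** Hadamard bounds det Y by the product of the Y_ii, which is det(diag v) times the product of the
    ratios [E i]. Their mean is at most 1, hence so is their product by AM-GM. Equality in both
    inequalities makes [Y] diagonal and the ratios equal. *)
Lemma det_le_diag_mx (Y : 'M[R]_n) : posdef Y ->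
  \sum_i Y i i / v 0 i <= n%:R ->
  \det Y <= \det (diag_mx v) /\ (\det Y = \det (diag_mx v) -> Y = diag_mx v).
Proof.
move=> pY trY; have [detY eqY] := hadamard pY.
pose E i := Y i i / v 0 i.
have E0 i : 0 < E i by rewrite divr_gt0// posdef_diag_gt0.
have YE : \prod_i Y i i = \prod_i v 0 i * \prod_i E i.
  by rewrite -big_split; apply: eq_bigr => i _; rewrite /E /= mulrC divfK ?gt_eqF.
have v_gt0 : 0 < \prod_i v 0 i by apply: prodr_gt0.
have /= [] := @leif_AGM R 'I_n predT E (fun i _ => ltW (E0 i)).
rewrite card_ord -/E; set m := _ / _ => Em Eeq.
have m1 : m ^+ n <= 1.
  have [->|n0] := posnP n; first by rewrite expr0.
  apply: exprn_ile1; first by rewrite divr_ge0// sumr_ge0// => i _; exact: ltW.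
  by rewrite ler_pdivrMr ?ltr0n// mul1r.
have Y_le : \prod_i Y i i <= \prod_i v 0 i.
  by rewrite YE ger_pMr// (le_trans Em).
rewrite det_diag; split=> [|detE]; first exact: le_trans Y_le.
have YvE : \prod_i Y i i = \prod_i v 0 i by apply/eqP; rewrite eq_le Y_le -detE.
have E1 : \prod_i E i = 1.
  by apply: (mulfI (lt0r_neq0 v_gt0)); rewrite -YE YvE mulr1.
have /esym : (\prod_i E i == m ^+ n) = true.
  by rewrite eq_le Em E1 m1.
rewrite Eeq => /esym/forall_inP Eij.
have Ei1 i : E i = 1.
  (* All ratios agree, so the n-th power of [E i] is their full product, which is 1. *)
  apply/eqP; rewrite -(@pexpr_eq1 _ _ n) ?ltW//; last by case: (n) i => [[]|].
  apply/eqP; rewrite -E1 -[n in LHS]card_ord -prodr_const.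
  by apply: eq_bigr => j _; apply/eqP; exact: (forall_inP (Eij i isT)).
have /is_diag_mxP dY : is_diag_mx Y by apply: eqY; rewrite detE.
apply/matrixP => i j; rewrite mxE; have [->|ij] := eqVneq i j.
  by rewrite mulr1n; move: (Ei1 j) => /divr1_eq.
by rewrite mulr0n dY.
Qed.

End diagonal_form.

(** * Averaging a competitor's constraint over the two slices *)

Section ball_slices.
Context {R : realType} {n : nat} (i : 'I_n).
Implicit Types (x d : 'cV[R]_n) (Y : 'M[R]_n) (g : R).

Let e : 'cV[R]_n := delta_mx i 0.

Lemma unit_ballE x : unit_ball x <-> inner x x <= 1.
Proof.
rewrite /unit_ball/= /enorm -[X in _ <= X]sqrtr1.
by rewrite ler_sqrt.
Qed.

(* Summing the constraints at the 2(n-1) points g e +- sqrt(1 - g^2) e_j, j <> i,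
   cancels the off-diagonal terms. *)
Lemma ball_slice_average Y d g : -1 <= g <= 1 ->
  ball_slice i g `<=` ellipsoid_of Y d ->
  (n%:R - 1) * inner (Y *m (g *: e - d)) (g *: e - d)
    + (1 - g ^+ 2) * \sum_(j | j != i) Y j j <= n%:R - 1.
Proof.
move=> g1 sub; pose r := Num.sqrt (1 - g ^+ 2).
have r2 : r ^+ 2 = 1 - g ^+ 2.
  by rewrite sqr_sqrtr//; case/andP: g1 => g1 g2; nra.
have pt j s : j != i -> s ^+ 2 = 1 ->
    inner (Y *m (g *: e - d + (s * r) *: delta_mx j 0))
      (g *: e - d + (s * r) *: delta_mx j 0) <= 1.
  move=> ji s2; rewrite addrAC; apply: (sub _); split.
    apply/unit_ballE.
    rewrite !(innerDl, innerDr, innerZl, innerZr) !inner_deltar !mxE !eqxx.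
    rewrite (negbTE ji) eq_sym (negbTE ji) !mulr0 !addr0 add0r !mulr1.
    by rewrite -!expr2 exprMn s2 r2 mul1r addrC subrK.
  by rewrite !mxE eqxx eq_sym (negbTE ji) mulr0 mulr1 addr0.
have each j : j != i -> inner (Y *m (g *: e - d)) (g *: e - d)
    + (1 - g ^+ 2) * Y j j <= 1.
  have N1 : (- 1) ^+ 2 = 1 :> R by rewrite sqrrN expr1n.
  move=> ji; have := lerD (pt j 1 ji (expr1n _ _)) (pt j _ ji N1).
  move: (g *: e - d) => w; rewrite !mulmxDr -!scalemxAr.
  rewrite !(innerDl, innerDr, innerZl, innerZr) inner_mul_delta -r2 => H.
  by nra.
have : \sum_(j | j != i) (inner (Y *m (g *: e - d)) (g *: e - d)
    + (1 - g ^+ 2) * Y j j) <= \sum_(j | j != i) 1.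
  by apply: ler_sum => j; exact: each.
have card_i : \sum_(j < n | j != i) (1 : R) = n%:R - 1.
  rewrite sumr_const cardC1 card_ord -subn1 natrB//.
  by case: (n) i => [[]|].
rewrite big_split/= -mulr_sumr card_i; congr (_ + _ <= _).
by rewrite -card_i mulr_suml; apply: eq_bigr => j _; rewrite mul1r.
Qed.

End ball_slices.

Section ball_slices_hull.
Context {R : realType} {n : nat} (i : 'I_n).
Variables (alpha beta tau a b : R).
Hypotheses (alphaN1 : -1 <= alpha) (beta1 : beta <= 1).
Hypotheses (tau_gt : alpha < tau) (tau_lt : tau < beta).
Hypotheses (a0 : 0 < a) (b0 : 0 < b) (n1 : (1 < n)%N).
(** The first two equations put the bounding spheres of the slices on the boundary of the ellipsoid.
    The third says that the two-point measure on alpha and beta with mean tau has variance 1/(n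
    a). *)
Hypothesis on_alpha : a * (tau - alpha) ^+ 2 + b * (1 - alpha ^+ 2) = 1.
Hypothesis on_beta : a * (beta - tau) ^+ 2 + b * (1 - beta ^+ 2) = 1.
Hypothesis balance : n%:R * a * (tau - alpha) * (beta - tau) = 1.

Let e : 'cV[R]_n := delta_mx i 0.
Let v : 'rV[R]_n := \row_j (if j == i then a else b).
Let K := convex_hull (ball_slice i alpha `|` ball_slice i beta).

Let v_gt0 j : 0 < v 0 j. Proof. by rewrite mxE; case: ifP. Qed.

(** On the slice the coordinate along [e] is fixed, and the other squares sum to at most 1 - g^2. *)
Lemma ball_slice_sub g : a * (g - tau) ^+ 2 + b * (1 - g ^+ 2) = 1 ->
  ball_slice i g `<=` ellipsoid_of (diag_mx v) (tau *: e).
Proof.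
move=> ge1 x [/unit_ballE x1 xi]; rewrite /ellipsoid_of/= inner_diag -ge1.
rewrite (bigD1 i)//= !mxE !eqxx mulr1 xi lerD2l.
rewrite (eq_bigr (fun j => b * x j 0 ^+ 2)) => [|j ji]; last first.
  by rewrite !mxE (negbTE ji) mulr0 subr0.
rewrite -mulr_sumr ler_pM2l// lerBrDl.
move: x1; rewrite /inner (bigD1 i)//= xi -expr2; apply: le_trans.
by rewrite lerD2l; apply: ler_sum => j _; rewrite -expr2.
Qed.

(* The weights (beta - tau) / (beta - alpha) and (tau - alpha) / (beta - alpha) on
   the two slices give a measure on the contact points with mean tau e and
   covariance X^-1 / n. *)
Lemma ellipsoid_trace_le Y d : K `<=` ellipsoid_of Y d -> posdef Y ->
  n%:R * inner (Y *m (tau *: e - d)) (tau *: e - d) + \sum_j Y j j / v 0 j <= n%:R.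
Proof.
move=> subK pY; have n0 : 1 < n%:R :> R by rewrite ltr1n.
have avg g : -1 <= g <= 1 -> g = alpha \/ g = beta ->
    (n%:R - 1) * (inner (Y *m (tau *: e - d)) (tau *: e - d)
      + 2 * (g - tau) * inner (Y *m (tau *: e - d)) e + (g - tau) ^+ 2 * Y i i)
    + (1 - g ^+ 2) * \sum_(j | j != i) Y j j <= n%:R - 1.
  move=> g1 gab; have := @ball_slice_average _ _ i Y d g g1.
  have -> : g *: delta_mx i 0 - d = (tau *: e - d) + (g - tau) *: e.
    by apply/colP => j; rewrite !mxE; ring.
  move: (tau *: e - d) => w.
  rewrite !mulmxDr -!scalemxAr !(innerDl, innerDr, innerZl, innerZr) inner_mul_delta.
  rewrite (inner_symmetric e w); last by case: pY.
  move=> avg; apply: (le_trans _ (avg _)).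
    by rewrite le_eqVlt; apply/orP; left; apply/eqP; ring.
  move=> x xg; apply: subK; apply: sub_gen_smallest.
  by case: gab => <-; [left|right].
have /avg : -1 <= alpha <= 1.
  by rewrite alphaN1 (ltW (lt_le_trans (lt_trans tau_gt tau_lt) beta1)).
move=> /(_ (or_introl erefl)) avg_alpha.
have /avg : -1 <= beta <= 1.
  by rewrite beta1 andbT (ltW (le_lt_trans alphaN1 (lt_trans tau_gt tau_lt))).
move=> /(_ (or_intror erefl)) avg_beta {avg}.
rewrite (bigD1 i)//= {1}/v mxE eqxx.
rewrite (eq_bigr (fun j => Y j j / b)) => [|j ji]; last first.
  by rewrite mxE (negbTE ji).
rewrite -mulr_suml.
(* From here on only real numbers matter: [T] is the transverse trace, [A] the form at tau e - d,
   [B] the cross term with [e], and [y] the entry along [e]. *)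
move: (\sum_(j | _) _) avg_alpha avg_beta => T.
move: (inner _ _) (inner _ _) (Y i i) => B A y avg_alpha avg_beta.
have wa : 0 < beta - tau by rewrite subr_gt0.
have wb : 0 < tau - alpha by rewrite subr_gt0.
(* With these weights, up to normalization by beta - alpha, the mean is tau, so the terms in [B]
   cancel in the sum. *)
move: avg_alpha avg_beta; rewrite -(ler_pM2l wa) => avg_alpha.
rewrite -(ler_pM2l wb) => avg_beta.
have := lerD avg_alpha avg_beta.
move: n0 (balance); set N : R := n%:R => n0 bal.
have aN0 : a != 0 by rewrite gt_eqF.
have bN0 : b != 0 by rewrite gt_eqF.
have Nn0 : N != 0 by rewrite gt_eqF// (lt_trans _ n0).
have E1 : (tau - alpha) * (beta - tau) = (N * a)^-1.
  apply: (mulfI (mulf_neq0 Nn0 aN0)); rewrite mulfV ?mulf_neq0//.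
  by rewrite -bal; ring.
have Ea : 1 - alpha ^+ 2 = (1 - a * (tau - alpha) ^+ 2) / b.
  by apply: (mulIf bN0); rewrite divfK // -[X in X - a * _]on_alpha; ring.
have Eb : 1 - beta ^+ 2 = (1 - a * (beta - tau) ^+ 2) / b.
  by apply: (mulIf bN0); rewrite divfK // -[X in X - a * _]on_beta; ring.
(* After division by (beta - alpha)(n - 1) this says that the variance in each transverse direction
   is 1/(n b). *)
have Eab : (beta - tau) * (1 - alpha ^+ 2) + (tau - alpha) * (1 - beta ^+ 2) =
    (beta - alpha) * (N - 1) / (N * b).
  rewrite Ea Eb.
  have -> : (beta - tau) * ((1 - a * (tau - alpha) ^+ 2) / b) +
    (tau - alpha) * ((1 - a * (beta - tau) ^+ 2) / b) =
    (beta - alpha) * (1 - a * ((tau - alpha) * (beta - tau))) / b by ring.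
  by rewrite E1; field; rewrite ?aN0 ?bN0 ?Nn0.
set lhs := (X in X <= _ -> _); set rhs := (X in _ <= X -> _) => H.
have k0 : 0 < (beta - alpha) * (N - 1) / N.
  by rewrite divr_gt0 ?(lt_trans _ n0)// mulr_gt0 ?subr_gt0 ?(lt_trans tau_gt).
rewrite -(ler_pM2l k0) (_ : _ * N = rhs); last by rewrite /rhs; field.
suff -> : (beta - alpha) * (N - 1) / N * (N * A + (y / a + T / b)) = lhs by [].
rewrite /lhs.
transitivity ((N - 1) * ((beta - alpha) * A
    + (beta - alpha) * ((tau - alpha) * (beta - tau)) * y)
  + ((beta - tau) * (1 - alpha ^+ 2) + (tau - alpha) * (1 - beta ^+ 2)) * T).
  by rewrite E1 Eab; field; rewrite ?aN0 ?bN0 ?Nn0.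
by ring.
Qed.

(** Containment reduces to the slices by convexity. For a competitor, dropping the nonnegative
    centre term from the trace inequality leaves the hypothesis of [det_le_diag_mx]. Equal volumes
    force Y = X; then the trace alone is already n, so the centre term must vanish. *)
Lemma ball_slices_hull_CE :
  is_CE K (ellipsoid_of (diag_mx v) (tau *: e)).
Proof.
have pX : posdef (diag_mx v) := posdef_diag_mx v_gt0.
split; first by exists (diag_mx v), (tau *: e).
  apply: smallest_sub; first exact: ellipsoid_convex.
  move=> x [|]; apply: ball_slice_sub => //.
  by rewrite -opprB sqrrN.
move=> _ [Y [d [pY ->]]] subK.
have trY := ellipsoid_trace_le subK pY.
have ge0Y := posdef_inner_ge0 (tau *: e - d) pY.
have trY' : \sum_j Y j j / v 0 j <= n%:R.
  by apply: le_trans trY; rewrite lerDr mulr_ge0.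
have [detY eqY] := det_le_diag_mx v_gt0 pY trY'.
split; first by rewrite volume_ellipsoid_le.
move=> volE; have YX : Y = diag_mx v.
  apply: eqY; apply/eqP; rewrite eq_le -(volume_ellipsoid_le (tau *: e) d pX pY).
  by rewrite -(volume_ellipsoid_le d (tau *: e) pY pX) volE lexx.
rewrite YX; congr ellipsoid_of; apply/eqP/contraT => cd.
have [_ /(_ (tau *: e - d))] := pY; rewrite subr_eq0 eq_sym => /(_ cd) gt0Y.
move: trY; rewrite {2}YX (eq_bigr (fun=> 1)) => [|j _]; last first.
  by rewrite mxE eqxx mulr1n divff// gt_eqF.
rewrite sumr_const card_ord leNgt ltrDr mulr_gt0// ltr0n.
by rewrite (ltn_trans _ n1).
Qed.

End ball_slices_hull.

(** * The closed-form parameters *)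

(** [Delta] is the discriminant of the displayed quadratic and [tau] its smaller root. The quadratic
    is positive at alpha and negative at the midpoint of alpha and beta; the two [gap] identities
    express these values through the discriminant. *)
Lemma tau_root (R : realType) (N alpha beta : R) : 1 < N -> -1 < alpha ->
  alpha < beta -> beta <= 1 -> 0 < beta + alpha ->
  let Delta := N ^+ 2 * (beta ^+ 2 - alpha ^+ 2) ^+ 2
               + 4 * (1 - alpha ^+ 2) * (1 - beta ^+ 2) in
  let tau := (N * (beta + alpha) ^+ 2 + 2 * (1 + alpha * beta) - Num.sqrt Delta)
             / (2 * (N + 1) * (beta + alpha)) in
  [/\ alpha < tau, 2 * tau < alpha + beta &
      (N + 1) * (beta + alpha) * tau ^+ 2
      - (N * (beta + alpha) ^+ 2 + 2 * (1 + alpha * beta)) * tau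
      + (beta + alpha) * (1 + N * alpha * beta) = 0].
Proof.
move=> N1 alphaN1 ab beta1 s0 Delta tau.
have al1 : 0 < 1 - alpha ^+ 2 by nra.
have ba0 : 0 < beta - alpha by rewrite subr_gt0.
have N0 : 0 < N by apply: lt_trans N1.
have be1 : 0 <= 1 - beta ^+ 2 by nra.
have D2 : Num.sqrt Delta ^+ 2 = Delta.
  rewrite sqr_sqrtr//; apply: addr_ge0; first exact: mulr_ge0 (sqr_ge0 _) (sqr_ge0 _).
  exact: mulr_ge0 (mulr_ge0 (ler0n R 4) (ltW al1)) be1.
have D0 : 0 <= Num.sqrt Delta by exact: sqrtr_ge0.
have A0 : 0 < (N + 1) * (beta + alpha) by rewrite mulr_gt0// addr_gt0.
pose B := N * (beta + alpha) ^+ 2 + 2 * (1 + alpha * beta).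
have tauE : 2 * ((N + 1) * (beta + alpha)) * tau = B - Num.sqrt Delta.
  rewrite /tau -/B [2 * (_ * _)]mulrA [LHS]mulrC divfK// gt_eqF//.
  by rewrite -mulrA mulr_gt0.
move: (Num.sqrt Delta) D0 D2 tauE => D D0 D2 tauE.
split.
- have gap : (B - 2 * ((N + 1) * (beta + alpha)) * alpha) ^+ 2 =
      D ^+ 2 + 4 * ((N + 1) * (beta + alpha)) * ((beta - alpha) * (1 - alpha ^+ 2)).
    by rewrite D2 /B /Delta; ring.
  have gap0 : 0 < 4 * ((N + 1) * (beta + alpha)) * ((beta - alpha) * (1 - alpha ^+ 2)).
    exact: mulr_gt0 (mulr_gt0 (ltr0Sn R 3) A0) (mulr_gt0 ba0 al1).
  have X0 : 0 < B - 2 * ((N + 1) * (beta + alpha)) * alpha.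
    rewrite (_ : _ - _ = N * ((beta + alpha) * (beta - alpha)) + 2 * (1 - alpha ^+ 2)).
      exact: addr_gt0 (mulr_gt0 N0 (mulr_gt0 s0 ba0)) (mulr_gt0 (ltr0Sn R 1) al1).
    by rewrite /B; ring.
  have : D < B - 2 * ((N + 1) * (beta + alpha)) * alpha.
    by rewrite -(@ltr_pXn2r _ 2)// ?nnegrE ?ltW// gap ltrDl.
  by move=> h; rewrite -(ltr_pM2l (mulr_gt0 (ltr0Sn R 1) A0)) tauE; lra.
- have gap : D ^+ 2 = (B - (N + 1) * (beta + alpha) * (alpha + beta)) ^+ 2
      + (N + 1) * (beta + alpha) * (beta + alpha) * (N - 1) * (beta - alpha) ^+ 2.
    by rewrite D2 /B /Delta; ring.
  have gap0 : 0 < (N + 1) * (beta + alpha) * (beta + alpha) * (N - 1)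
      * (beta - alpha) ^+ 2.
    by rewrite mulr_gt0 ?exprn_gt0// mulr_gt0 ?subr_gt0// mulr_gt0.
  have : B - (N + 1) * (beta + alpha) * (alpha + beta) < D.
    rewrite ltNge; apply/negP => DX.
    have : D ^+ 2 <= (B - (N + 1) * (beta + alpha) * (alpha + beta)) ^+ 2.
      by rewrite ler_pXn2r// ?nnegrE ?(le_trans D0).
    by rewrite gap leNgt ltrDl gap0.
  move=> h; rewrite -(ltr_pM2l A0) mulrA (mulrC _ 2) tauE; lra.
- apply: (mulfI (lt0r_neq0 (mulr_gt0 (ltr0Sn R 3) A0))); rewrite mulr0.
  rewrite -/B.
  transitivity ((2 * ((N + 1) * (beta + alpha)) * tau - B) ^+ 2 - B ^+ 2
    + 4 * ((N + 1) * (beta + alpha)) * ((beta + alpha) * (1 + N * alpha * beta))).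
    by ring.
  by rewrite tauE (_ : B - D - B = - D) 1?sqrrN ?D2 /B /Delta; ring.
Qed.

(** The formula for [a] solves the balance equation and that for [b] the contact equation at alpha.
    Contact at beta is then equivalent to the quadratic equation for tau. *)
Lemma contact_equations (R : realType) (N alpha beta tau : R) :
  let a := 1 / (N * (tau - alpha) * (beta - tau)) in
  let b := (1 - a * (tau - alpha) ^+ 2) / (1 - alpha ^+ 2) in
  1 < N -> 0 < 1 - alpha ^+ 2 -> alpha < tau -> 2 * tau < alpha + beta ->
  (N + 1) * (beta + alpha) * tau ^+ 2
    - (N * (beta + alpha) ^+ 2 + 2 * (1 + alpha * beta)) * tau
    + (beta + alpha) * (1 + N * alpha * beta) = 0 ->
  [/\ 0 < a, 0 < b & [/\ a * (tau - alpha) ^+ 2 + b * (1 - alpha ^+ 2) = 1,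
      a * (beta - tau) ^+ 2 + b * (1 - beta ^+ 2) = 1 &
      N * a * (tau - alpha) * (beta - tau) = 1]].
Proof.
move=> a b N1 al1 tau_gt tau_lt root.
have u0 : 0 < tau - alpha by rewrite subr_gt0.
have w0 : 0 < beta - tau by lra.
have N0 : 0 < N by apply: lt_trans N1.
have a0 : 0 < a by rewrite divr_gt0// !mulr_gt0.
have balance : N * a * (tau - alpha) * (beta - tau) = 1.
  by rewrite /a; field; rewrite !gt_eqF.
have nz : [&& N != 0, beta - tau != 0, tau - alpha != 0 & 1 - alpha ^+ 2 != 0].
  by rewrite !gt_eqF.
split=> //.
  rewrite divr_gt0// subr_gt0 -balance expr2 mulrA -subr_gt0.
  (* The last factor is positive because tau lies left of the midpoint and N > 1. *)
  rewrite (_ : _ - _ = a * (tau - alpha) * (N * (beta - tau) - (tau - alpha))).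
    by apply: mulr_gt0 (mulr_gt0 a0 u0) _; nra.
  by ring.
split=> //; first by rewrite divfK ?gt_eqF// addrC subrK.
apply/eqP; rewrite -subr_eq0; apply/eqP; rewrite /b /a.
case/and4P: nz => nz1 nz2 nz3 nz4.
(* The 0 stands for the quadratic in tau: the residual at beta is that quadratic times (beta -
   alpha) over the common denominator. *)
transitivity ((beta - alpha) * 0 / (N * (tau - alpha) * (beta - tau) * (1 - alpha ^+ 2))).
  by rewrite -root; field; rewrite nz1 nz2 nz3 nz4.
by rewrite mulr0 mul0r.
Qed.

Theorem theorem8p1 (R : realType) (n : nat) (hn : (1 < n)%N)
    (alpha beta : R)
    (h_alpha : -1 <= alpha) (h_alpha_beta : alpha < beta) (h_beta : beta <= 1)
    (h_sq : alpha ^+ 2 <= beta ^+ 2)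
    (h_ne : (alpha, beta) <> (-1, 1)) :
  let i1 : 'I_n := Ordinal (ltnW hn) in
  let e1 : 'cV[R]_n := delta_mx i1 0 in
  let Q : set 'cV[R]_n := convex_hull (ball_slice i1 alpha `|` ball_slice i1 beta) in
  let Delta := n%:R ^+ 2 * (beta ^+ 2 - alpha ^+ 2) ^+ 2
               + 4 * (1 - alpha ^+ 2) * (1 - beta ^+ 2) in
  exists a b tau : R,
    [/\ 0 < a, 0 < b, alpha < tau < beta &
        is_CE Q (ellipsoid_of
                   (diag_mx (\row_(i < n) (if i == i1 then a else b)))
                   (tau *: e1))]
    /\
    [/\ alpha * beta = -1 / n%:R ->
          [/\ tau = 0, a = 1 & b = 1],
        alpha + beta = 0 -> alpha * beta <> -1 / n%:R ->
          [/\ tau = 0,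
              a = 1 / (n%:R * beta ^+ 2) &
              b = (n%:R - 1) / (n%:R * (1 - beta ^+ 2))] &
        alpha + beta <> 0 -> alpha * beta <> -1 / n%:R ->
          [/\ tau = (n%:R * (beta + alpha) ^+ 2 + 2 * (1 + alpha * beta)
                     - Num.sqrt Delta) / (2 * (n%:R + 1) * (beta + alpha)),
              a = 1 / (n%:R * (tau - alpha) * (beta - tau)) &
              b = (1 - a * (tau - alpha) ^+ 2) / (1 - alpha ^+ 2)]].
Proof.
move=> i1 e1 Q Delta.
have N1 : 1 < n%:R :> R by rewrite ltr1n.
have N0 : n%:R != 0 :> R by rewrite gt_eqF// (lt_trans _ N1).
have alphaN1 : -1 < alpha.
  (* If alpha = -1, then beta^2 >= 1 and beta > -1 force beta = 1, the excluded pair. *)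
  rewrite lt_neqAle h_alpha andbT; apply/eqP => alphaE; apply: h_ne.
  have b1 : 1 <= beta by have := h_alpha_beta; have := h_sq; rewrite -alphaE; nra.
  by rewrite -alphaE (le_anti (introT andP (conj h_beta b1))).
have al1 : 0 < 1 - alpha ^+ 2 by nra.
have CE a b tau : 0 < a -> 0 < b -> alpha < tau < beta ->
    [/\ a * (tau - alpha) ^+ 2 + b * (1 - alpha ^+ 2) = 1,
        a * (beta - tau) ^+ 2 + b * (1 - beta ^+ 2) = 1 &
        n%:R * a * (tau - alpha) * (beta - tau) = 1] ->
    [/\ 0 < a, 0 < b, alpha < tau < beta &
        is_CE Q (ellipsoid_of
          (diag_mx (\row_(i < n) (if i == i1 then a else b))) (tau *: e1))].
  move=> a0 b0 /[dup] tau_in /andP[tau_gt tau_lt] [on_alpha on_beta balance].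
  by split=> //; exact: (@ball_slices_hull_CE _ _ i1 alpha beta).
have [abE|abN] := eqVneq (alpha * beta) (-1 / n%:R).
  have nab : n%:R * (alpha * beta) = -1 by rewrite abE mulrC divfK.
  have ab0 : alpha * beta < 0 by nra.
  (* The ellipsoid is the unit ball itself: both contact equations are trivial, and balance reads -n
     alpha beta = 1. *)
  exists 1, 1, 0; split; last by split=> // _; rewrite abE.
  apply: CE => //; first by nra.
  split; try by ring.
  by rewrite -[RHS]opprK -nab; ring.
have [s0|sN0] := eqVneq (alpha + beta) 0.
  have alphaE : alpha = - beta by apply/eqP; rewrite -addr_eq0 s0.
  have beta0 : 0 < beta by lra.
  have be1 : 0 < 1 - beta ^+ 2 by rewrite alphaE sqrrN in al1.
  have beN0 : beta != 0 by rewrite gt_eqF.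
  have beN1 : 1 - beta ^+ 2 != 0 by rewrite gt_eqF.
  exists (1 / (n%:R * beta ^+ 2)), ((n%:R - 1) / (n%:R * (1 - beta ^+ 2))), 0.
  split; last by split=> //; rewrite ?s0 ?eqxx// => E; rewrite E eqxx in abN.
  have N_gt0 : 0 < n%:R :> R by exact: lt_trans N1.
  apply: CE.
  - by rewrite divr_gt0// mulr_gt0 ?exprn_gt0.
  - by rewrite divr_gt0 ?subr_gt0// mulr_gt0.
  - by rewrite beta0 alphaE oppr_lt0 beta0.
  - by rewrite alphaE sqrrN; split; field; rewrite ?N0 ?beN0 ?beN1.
(* From beta^2 - alpha^2 = (beta - alpha)(beta + alpha) >= 0 and a nonzero sum. *)
have s_gt0 : 0 < beta + alpha.
  rewrite lt_neqAle eq_sym addrC sN0/=.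
  have := h_sq; rewrite -subr_ge0 subr_sqr pmulr_rge0 ?subr_gt0//.
  by rewrite addrC.
have [tau_gt tau_lt root] := tau_root N1 alphaN1 h_alpha_beta h_beta s_gt0.
rewrite -/Delta in tau_gt tau_lt root.
have [a0 b0 contact] := contact_equations N1 al1 tau_gt tau_lt root.
(* The witnesses stay open until the formulas of the third case fix them by reflexivity. *)
eexists _, _, _; split; last first.
  split=> [E|E|_ _]; [by rewrite E eqxx in abN|by rewrite E eqxx in sN0|].
  by split; reflexivity.
apply: CE => //; rewrite tau_gt/=; lra.
Qed.
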